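(* The dimensional-splitting scheme described in the context (row sweeps (R1)--(R7), column sweeps (C1)--(C7), and the update (U)) is energy stable, and every solution of it satisfies the following discrete energy dissipation law for every $n\in\{0,\dots,N-1\}$: $$\frac{\mathcal{W}^{n+1}-\mathcal{W}^{n}}{\Delta t}\le -\Delta x\Delta y\sum_{p=1}^{N_x}\sum_{j=1}^{N_y-1}\min\left\{M(\widehat\phi_{p,j}^{n,p},\widehat\phi_{p,j+1}^{n,p}),M(\widehat\phi_{p,j+1}^{n,p},\widehat\phi_{p,j}^{n,p})\right\}\left|\widehat V_{p,j+\frac12}^{n,p}\right|^2$$ $$\qquad-\Delta x\Delta y\sum_{i=1}^{N_x-1}\sum_{q=1}^{N_y}\min\left\{M(\widetilde\phi_{i,q}^{n,q},\widetilde\phi_{i+1,q}^{n,q}),M(\widetilde\phi_{i+1,q}^{n,q},\widetilde\phi_{i,q}^{n,q})\right\}\left|\widetilde V_{i+\frac12,q}^{n,q}\right|^2\le 0,$$ where $$\mathcal{W}^{n}=\Delta x\Delta y\sum_{i=1}^{N_x-1}\sum_{j=1}^{N_y}\frac{\varepsilon^2}{2}\left(\frac{\phi_{i+1,j}^{n}-\phi_{i,j}^{n}}{\Delta x}\right)^2+\Delta x\Delta y\sum_{i=1}^{N_x}\sum_{j=1}^{N_y-1}\frac{\varepsilon^2}{2}\left(\frac{\phi_{i,j+1}^{n}-\phi_{i,j}^{n}}{\Delta y}\right)^2+\Delta x\Delta y\sum_{i=1}^{N_x}\sum_{j=1}^{N_y}F(\phi_{i,j}^{n})+\Delta x\sum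_{i=1}^{N_x}g(\phi_{i,1}^{n}).$$
   Context: Parameters: real numbers $0<\varepsilon\ll1$ (interface width), $\kappa>0$ (contact line mobility), time step $\Delta t>0$, spatial steps $\Delta x>0$, $\Delta y>0$, prescribed contact angle $\theta_s\in[0,\pi]$, and positive integers $N_x,N_y,N$. A rectangular domain is divided into cells indexed by $i=1,\dots,N_x$, $j=1,\dots,N_y$; the row $j=1$ is adjacent to the substrate $\Gamma_w$. $\phi_{i,j}^n$ denotes the (approximate) cell average of the phase variable at time $n\Delta t$. Potential: $F$ is one of the following. (Logarithmic Flory--Huggins) $F(\chi)=F_{log}(\chi)-F_{log}(\beta)$ with $F_{log}(\chi)=\frac{\theta}{2}[(1+\chi)\ln(1+\chi)+(1-\chi)\ln(1-\chi)]+\frac12(1-\chi^2)$, $0<\theta<1$, where $\beta\in(0,1)$ is the positive root of $F_{log}'(\chi)=\frac{\theta}{2}\ln\frac{1+\chi}{1-\chi}-\chi=0$; (Polynomial) $F(\chi)=\frac14(1-\chi^2)^2$, with $\beta=1$. Put $c_F=\int_{-\beta}^{\beta}\sqrt{2F(\chi)}\,d\chi$ and $g(\chi)=\frac{\varepsilon c_F\cos\theta_s}{4\beta^3}(\chi^3-3\beta^2\chi)$. Notation: $\chi^+=\max\{\chi,0\}$, $\chi^-=\min\{\chi,0\}$, and the two-state upwind mobility is $M(\chi_1,\chi_2)=(1+\chi_1)^+(1-\chi_2)^+$. For an array $\psi$ with ghost values, $(\Delta\psi)_{i,j}=\frac{\psi_{i+1,j}-2\psi_{i,j}+\psi_{i-1,j}}{\Delta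 x^2}+\frac{\psi_{i,j+1}-2\psi_{i,j}+\psi_{i,j-1}}{\Delta y^2}$. Scheme: a solution consists of $\phi_{i,j}^n$ ($0\le n\le N$) together with, for each $n=0,\dots,N-1$, intermediate quantities satisfying the following. Step 1 (row sweeps). Set $\widetilde\phi_{i,j}^{n,0}=\phi_{i,j}^n$. For $q=1,\dots,N_y$ there are values $\widetilde\phi_{i,j}^{n,q},\widetilde\mu_{i,j}^{n,q}$, fluxes $\widetilde J^{n,q}$, velocities $\widetilde V^{n,q}$, scalars $\widetilde\xi^{n,q},\widetilde\eta^{n,q}$ and ghost values with: (R1) $\widetilde\phi_{i,j}^{n,q}-\widetilde\phi_{i,j}^{n,q-1}=-\frac{\Delta t}{\Delta x}(\widetilde J_{i+\frac12,j}^{n,q}-\widetilde J_{i-\frac12,j}^{n,q})$ if $j=q$, and $=0$ otherwise. (R2) $\widetilde J_{i+\frac12,j}^{n,q}=(\widetilde V_{i+\frac12,j}^{n,q})^+M(\widetilde\phi_{i,j}^{n,q},\widetilde\phi_{i+1,j}^{n,q})+(\widetilde V_{i+\frac12,j}^{n,q})^-M(\widetilde\phi_{i+1,j}^{n,q},\widetilde\phi_{i,j}^{n,q})$, with $\widetilde V_{i+\frac12,j}^{n,q}=-\frac1{\Delta x}(\widetilde\mu_{i+1,j}^{n,q}-\widetilde\mu_{i,j}^{n,q})$ (faces between two cells; boundary faces are covered by (R3)). (R3) No flux: $\widetilde J_{\frac12,j}^{n,q}=\widetilde J_{N_x+\frac12,j}^{n,q}=0$ for all $j$. (R4) $\widetilde\mu_{i,j}^{n,q}=-\varepsilon^2(\Delta\widetilde\phi)_{i,j}^{n,q}+\widetilde\xi^{n,q}F'(\widetilde\phi_{i,j}^{n,q})$.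 (R5) $\sum_{i,j}(F(\widetilde\phi_{i,j}^{n,q})-F(\widetilde\phi_{i,j}^{n,q-1}))=\widetilde\xi^{n,q}\sum_{i,j}F'(\widetilde\phi_{i,j}^{n,q})(\widetilde\phi_{i,j}^{n,q}-\widetilde\phi_{i,j}^{n,q-1})$ (sums over all cells). (R6) $\sum_{i=1}^{N_x}(g(\widetilde\phi_{i,1}^{n,q})-g(\widetilde\phi_{i,1}^{n,q-1}))=\widetilde\eta^{n,q}\sum_{i=1}^{N_x}g'(\widetilde\phi_{i,1}^{n,q})(\widetilde\phi_{i,1}^{n,q}-\widetilde\phi_{i,1}^{n,q-1})$. (R7) Ghost values: $\widetilde\phi_{0,j}^{n,q}=\widetilde\phi_{1,j}^{n,q}$, $\widetilde\phi_{N_x+1,j}^{n,q}=\widetilde\phi_{N_x,j}^{n,q}$, $\widetilde\phi_{i,N_y+1}^{n,q}=\widetilde\phi_{i,N_y}^{n,q}$, $\widetilde\phi_{i,0}^{n,q}=\widetilde\phi_{i,1}^{n,q}-\frac{\Delta y}{\varepsilon^2}\left(\frac{\widetilde\phi_{i,1}^{n,q}-\widetilde\phi_{i,1}^{n,q-1}}{\kappa\Delta t}+\widetilde\eta^{n,q}g'(\widetilde\phi_{i,1}^{n,q})\right)$. (These implement the dynamic contact line condition $\frac{\widetilde\phi_{i,1}^{n,q}-\widetilde\phi_{i,1}^{n,q-1}}{\kappa\Delta t}=\varepsilon^2\frac{\widetilde\phi_{i,1}^{n,q}-\widetilde\phi_{i,0}^{n,q}}{\Delta y}-\widetilde\eta^{n,q}g'(\widetilde\phi_{i,1}^{n,q})$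 for $q=1$; for $q\ne1$ the left-hand side is $0$.) Step 2 (column sweeps). Set $\widehat\phi_{i,j}^{n,0}=\widetilde\phi_{i,j}^{n,N_y}$. For $p=1,\dots,N_x$ there are values $\widehat\phi_{i,j}^{n,p},\widehat\mu_{i,j}^{n,p}$, fluxes $\widehat J^{n,p}$, velocities $\widehat V^{n,p}$, scalars $\widehat\xi^{n,p},\widehat\eta^{n,p}$ and ghost values with: (C1) $\widehat\phi_{i,j}^{n,p}-\widehat\phi_{i,j}^{n,p-1}=-\frac{\Delta t}{\Delta y}(\widehat J_{i,j+\frac12}^{n,p}-\widehat J_{i,j-\frac12}^{n,p})$ if $i=p$, and $=0$ otherwise. (C2) $\widehat J_{i,j+\frac12}^{n,p}=(\widehat V_{i,j+\frac12}^{n,p})^+M(\widehat\phi_{i,j}^{n,p},\widehat\phi_{i,j+1}^{n,p})+(\widehat V_{i,j+\frac12}^{n,p})^-M(\widehat\phi_{i,j+1}^{n,p},\widehat\phi_{i,j}^{n,p})$, with $\widehat V_{i,j+\frac12}^{n,p}=-\frac1{\Delta y}(\widehat\mu_{i,j+1}^{n,p}-\widehat\mu_{i,j}^{n,p})$ (faces between two cells; boundary faces are covered by (C3)). (C3) No flux: $\widehat J_{i,\frac12}^{n,p}=\widehat J_{i,N_y+\frac12}^{n,p}=0$ for all $i$. (C4) $\widehat\mu_{i,j}^{n,p}=-\varepsilon^2(\Delta\widehat\phi)_{i,j}^{n,p}+\widehat\xi^{n,p}F'(\widehat\phi_{i,j}^{n,p})$. (C5) $\sum_{i,j}(F(\widehat\phi_{i,j}^{n,p})-F(\widehat\phi_{i,j}^{n,p-1}))=\widehat\xi^{n,p}\sum_{i,j}F'(\widehat\phi_{i,j}^{n,p})(\widehat\phi_{i,j}^{n,p}-\widehat\phi_{i,j}^{n,p-1})$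 (sums over all cells). (C6) $\sum_{i=1}^{N_x}(g(\widehat\phi_{i,1}^{n,p})-g(\widehat\phi_{i,1}^{n,p-1}))=\widehat\eta^{n,p}\sum_{i=1}^{N_x}g'(\widehat\phi_{i,1}^{n,p})(\widehat\phi_{i,1}^{n,p}-\widehat\phi_{i,1}^{n,p-1})$. (C7) Ghost values: $\widehat\phi_{0,j}^{n,p}=\widehat\phi_{1,j}^{n,p}$, $\widehat\phi_{N_x+1,j}^{n,p}=\widehat\phi_{N_x,j}^{n,p}$, $\widehat\phi_{i,N_y+1}^{n,p}=\widehat\phi_{i,N_y}^{n,p}$, $\widehat\phi_{i,0}^{n,p}=\widehat\phi_{i,1}^{n,p}-\frac{\Delta y}{\varepsilon^2}\left(\frac{\widehat\phi_{i,1}^{n,p}-\widehat\phi_{i,1}^{n,p-1}}{\kappa\Delta t}+\widehat\eta^{n,p}g'(\widehat\phi_{i,1}^{n,p})\right)$. (These implement the dynamic contact line condition $\frac{\widehat\phi_{i,1}^{n,p}-\widehat\phi_{i,1}^{n,p-1}}{\kappa\Delta t}=\varepsilon^2\frac{\widehat\phi_{i,1}^{n,p}-\widehat\phi_{i,0}^{n,p}}{\Delta y}-\widehat\eta^{n,p}g'(\widehat\phi_{i,1}^{n,p})$ for $i=p$; for $i\ne p$ the left-hand side is $0$.) (U) $\phi_{i,j}^{n+1}=\widehat\phi_{i,j}^{n,N_x}$, and $\xi^{n+1}=\frac{\sum_{q=1}^{N_y}\widetilde\xi^{n,q}+\sum_{p=1}^{N_x}\widehat\xi^{n,p}}{N_y+N_x}$,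 $\eta^{n+1}=\frac{\sum_{q=1}^{N_y}\widetilde\eta^{n,q}+\sum_{p=1}^{N_x}\widehat\eta^{n,p}}{N_y+N_x}$. *)

(* Defs.v *)
From HB Require Import structures.
From mathcomp Require Import all_boot all_order all_algebra.
From mathcomp Require Import all_classical all_reals all_analysis.
Set Implicit Arguments.
Unset Strict Implicit.
Unset Printing Implicit Defensive.
Import Order.TTheory GRing.Theory Num.Theory.
Import numFieldNormedType.Exports.
Local Open Scope classical_set_scope.
Local Open Scope ring_scope.

Section Potential.
Context {R : realType}.
Implicit Types (theta beta x : R) (F : R -> R).

(* [ln] is 0 on nonpositive arguments: at x = 1 and x = -1 this gives the usual
   convention 0 ln 0 = 0; for |x| > 1 the values are a mere totalization. *)
Definition F_log theta x : R :=
  theta / 2 * ((1 + x) * ln (1 + x) + (1 - x) * ln (1 - x))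
  + 1 / 2 * (1 - x ^+ 2).

Definition F_poly x : R := 1 / 4 * (1 - x ^+ 2) ^+ 2.

(* [potential beta F]: F is one of the two admissible potentials, and beta is
   the positive equilibrium value that goes with it. *)
Inductive potential : R -> (R -> R) -> Prop :=
| potential_log theta beta :
    0 < theta < 1 -> 0 < beta < 1 -> derive1 (F_log theta) beta = 0 ->
    potential beta (fun x => F_log theta x - F_log theta beta)
| potential_poly : potential 1 F_poly.

Definition c_F beta F : R :=
  \int[lebesgue_measure]_(x in `[- beta, beta]) Num.sqrt (2 * F x).

Definition wall_energy (eps thetas : R) beta F x : R :=
  eps * c_F beta F * cos thetas / (4 * beta ^+ 3)
  * (x ^+ 3 - 3 * beta ^+ 2 * x).

End Potential.

Section Scheme.
Context {R : realType}.

Definition mobility (x1 x2 : R) : R :=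
  Num.max (1 + x1) 0 * Num.max (1 - x2) 0.

Definition upwind_flux (v a b : R) : R :=
  Num.max v 0 * mobility a b + Num.min v 0 * mobility b a.

(* The unknowns of one sweep.  Cells are indexed from 1, and the indices 0,
   Nx.+1, Ny.+1 of [sphi] carry the ghost values.  In a row sweep, [sflux i j]
   and [svel i j] live on the face (i + 1/2, j); in a column sweep, on the face
   (i, j + 1/2).  So index 0 and index Nx (resp. Ny) denote boundary faces. *)
Record sweep := Sweep {
  sphi : nat -> nat -> R;
  smu : nat -> nat -> R;
  sflux : nat -> nat -> R;
  svel : nat -> nat -> R;
  sxi : R;
  seta : R }.

Variables (eps kappa dt dx dy : R) (F g : R -> R) (Nx Ny : nat).
Implicit Types (s : sweep) (prev psi : nat -> nat -> R).

Definition laplacian psi (i j : nat) : R :=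
  (psi i.+1 j - 2 * psi i j + psi i.-1 j) / dx ^+ 2
  + (psi i j.+1 - 2 * psi i j + psi i j.-1) / dy ^+ 2.

Definition cell (i j : nat) : bool := (1 <= i <= Nx)%N && (1 <= j <= Ny)%N.

(* The relations shared by row and column sweeps; [prev] is the phase variable
   before the sweep. *)
Record sweep_common prev s : Prop := {
  chemical_potential : forall i j, cell i j ->
    smu s i j
    = - (eps ^+ 2) * laplacian (sphi s) i j + sxi s * derive1 F (sphi s i j);
  bulk_multiplier :
    \sum_(1 <= i < Nx.+1) \sum_(1 <= j < Ny.+1) (F (sphi s i j) - F (prev i j))
    = sxi s * \sum_(1 <= i < Nx.+1) \sum_(1 <= j < Ny.+1)
                derive1 F (sphi s i j) * (sphi s i j - prev i j);
  wall_multiplier :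
    \sum_(1 <= i < Nx.+1) (g (sphi s i 1%N) - g (prev i 1%N))
    = seta s * \sum_(1 <= i < Nx.+1)
                 derive1 g (sphi s i 1%N) * (sphi s i 1%N - prev i 1%N);
  ghost_left : forall j, (1 <= j <= Ny)%N -> sphi s 0%N j = sphi s 1%N j;
  ghost_right : forall j, (1 <= j <= Ny)%N -> sphi s Nx.+1 j = sphi s Nx j;
  ghost_top : forall i, (1 <= i <= Nx)%N -> sphi s i Ny.+1 = sphi s i Ny;
  ghost_wall : forall i, (1 <= i <= Nx)%N ->
    sphi s i 0%N
    = sphi s i 1%N
      - dy / eps ^+ 2 * ((sphi s i 1%N - prev i 1%N) / (kappa * dt)
                         + seta s * derive1 g (sphi s i 1%N)) }.

Record row_sweep (q : nat) prev s : Prop := {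
  row_update : forall i j, cell i j ->
    sphi s i j - prev i j
    = if j == q then - (dt / dx) * (sflux s i j - sflux s i.-1 j) else 0;
  row_velocity : forall i j, (1 <= i < Nx)%N -> (1 <= j <= Ny)%N ->
    svel s i j = - (1 / dx) * (smu s i.+1 j - smu s i j);
  row_flux : forall i j, (1 <= i < Nx)%N -> (1 <= j <= Ny)%N ->
    sflux s i j = upwind_flux (svel s i j) (sphi s i j) (sphi s i.+1 j);
  row_no_flux : forall j, (1 <= j <= Ny)%N ->
    sflux s 0%N j = 0 /\ sflux s Nx j = 0;
  row_common : sweep_common prev s }.

Record column_sweep (p : nat) prev s : Prop := {
  column_update : forall i j, cell i j ->
    sphi s i j - prev i j
    = if i == p then - (dt / dy) * (sflux s i j - sflux s i j.-1) else 0;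
  column_velocity : forall i j, (1 <= i <= Nx)%N -> (1 <= j < Ny)%N ->
    svel s i j = - (1 / dy) * (smu s i j.+1 - smu s i j);
  column_flux : forall i j, (1 <= i <= Nx)%N -> (1 <= j < Ny)%N ->
    sflux s i j = upwind_flux (svel s i j) (sphi s i j) (sphi s i j.+1);
  column_no_flux : forall i, (1 <= i <= Nx)%N ->
    sflux s i 0%N = 0 /\ sflux s i Ny = 0;
  column_common : sweep_common prev s }.

(* [row n q] and [col n p] are the states after the q-th row sweep and the p-th
   column sweep of time step n.  At q = 0 and p = 0 only the cell values of
   [sphi] are meaningful. *)
Record time_step (n : nat) (phi : nat -> nat -> nat -> R)
    (row col : nat -> nat -> sweep) (xi eta : nat -> R) : Prop := {
  row_init : forall i j, cell i j -> sphi (row n 0%N) i j = phi n i j;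
  row_sweeps : forall q, (1 <= q <= Ny)%N ->
    row_sweep q (sphi (row n q.-1)) (row n q);
  column_init : forall i j, cell i j ->
    sphi (col n 0%N) i j = sphi (row n Ny) i j;
  column_sweeps : forall p, (1 <= p <= Nx)%N ->
    column_sweep p (sphi (col n p.-1)) (col n p);
  phi_update : forall i j, cell i j -> phi n.+1 i j = sphi (col n Nx) i j;
  xi_update :
    xi n.+1 = (\sum_(1 <= q < Ny.+1) sxi (row n q)
               + \sum_(1 <= p < Nx.+1) sxi (col n p)) / (Ny + Nx)%:R;
  eta_update :
    eta n.+1 = (\sum_(1 <= q < Ny.+1) seta (row n q)
                + \sum_(1 <= p < Nx.+1) seta (col n p)) / (Ny + Nx)%:R }.

Definition scheme_solution (N : nat) (phi : nat -> nat -> nat -> R)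
    (row col : nat -> nat -> sweep) (xi eta : nat -> R) : Prop :=
  forall n, (n < N)%N -> time_step n phi row col xi eta.

Definition discrete_energy psi : R :=
  dx * dy * (\sum_(1 <= i < Nx) \sum_(1 <= j < Ny.+1)
               eps ^+ 2 / 2 * ((psi i.+1 j - psi i j) / dx) ^+ 2)
  + dx * dy * (\sum_(1 <= i < Nx.+1) \sum_(1 <= j < Ny)
                 eps ^+ 2 / 2 * ((psi i j.+1 - psi i j) / dy) ^+ 2)
  + dx * dy * (\sum_(1 <= i < Nx.+1) \sum_(1 <= j < Ny.+1) F (psi i j))
  + dx * (\sum_(1 <= i < Nx.+1) g (psi i 1%N)).

End Scheme.

(* Main.v *)
Require Import Defs.
From HB Require Import structures.
From mathcomp Require Import all_boot all_order all_algebra.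
From mathcomp Require Import all_classical all_reals all_analysis.
From mathcomp Require Import ring lra.
Set Implicit Arguments.
Unset Strict Implicit.
Unset Printing Implicit Defensive.
Import Order.TTheory GRing.Theory Num.Theory.
Import numFieldNormedType.Exports.
Local Open Scope ring_scope.

(** Every sweep separately dissipates the energy, and the sweeps of one time
    step telescope from [phi n] to [phi n.+1].

    For one sweep, write [u] for the new phase variable, [v] for the old one
    and [d = u - v].  The gradient terms of the energy are convex quadratics
    evaluated implicitly, so [(a ^+ 2 - b ^+ 2) / 2 <= a * (a - b)] bounds
    their increment by a bilinear expression in [u] and [d].  Summation by
    parts turns it into [- eps ^+ 2] times the sum of [d] times the discrete
    Laplacian of [u], plus a boundary term on the substrate
    ([dirichlet_increment_le]).  The multipliers [xi] and [eta] are chosen so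
    that the nonlinear increments of [F] and [g] equal their linearizations
    scaled by the multipliers, exactly.  The bulk terms then assemble into the
    sum of [mu * d].  In the wall terms the ghost value makes the two
    contributions of [eta * g'] cancel and leaves
    [- d ^+ 2 / (kappa * dt) <= 0] ([sweep_common_dissipation]).

    A sweep moves mass along a single line of cells, by upwind fluxes [J]
    driven by [V = - (difference of mu) / h].  A second summation by parts
    gives the sum of [mu * d] over that line as [- dt] times the sum of
    [J * V] ([flux_work_le]), and upwinding makes [J * V] at least the smaller
    of the two face mobilities times [V ^+ 2] ([upwind_flux_dissipation]). *)

(** * One-dimensional tools *)

(** Abel summation on a line of [N] cells: [a i] lives on the face between the
    cells [i] and [i.+1], so [a 0] and [a N] are the boundary faces. *)
Lemma summation_by_parts (R : comPzRingType) (N : nat) (a d : nat -> R) :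
  (0 < N)%N ->
  \sum_(1 <= i < N.+1) d i * (a i - a i.-1)
  = d N * a N - d 1%N * a 0%N - \sum_(1 <= i < N) a i * (d i.+1 - d i).
Proof.
case: N => // N _; elim: N => [|N IHN].
  by rewrite big_nat1 big_geq //= mulrBr subr0.
rewrite big_nat_recr //= IHN [in RHS]big_nat_recr //=; ring.
Qed.

(** The increment of a convex quadratic is at most its derivative at the new
    state times the increment of the argument; after summation by parts the
    derivative is minus the second difference. *)
Lemma dirichlet_increment_le (R : realFieldType) (N : nat) (c h : R)
    (u v : nat -> R) :
  (0 < N)%N -> 0 <= c ->
  \sum_(1 <= i < N) c / 2 * ((u i.+1 - u i) / h) ^+ 2
  - \sum_(1 <= i < N) c / 2 * ((v i.+1 - v i) / h) ^+ 2
  <= - c * (\sum_(1 <= i < N.+1)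
               (u i - v i) * ((u i.+1 - 2 * u i + u i.-1) / h ^+ 2))
     + c / h ^+ 2 * ((u N - v N) * (u N.+1 - u N)
                     - (u 1%N - v 1%N) * (u 1%N - u 0%N)).
Proof.
move=> N0 c0; set d := fun i => u i - v i.
set a := fun i => u i.+1 - u i.
have -> : \sum_(1 <= i < N.+1)
            (u i - v i) * ((u i.+1 - 2 * u i + u i.-1) / h ^+ 2)
          = h ^- 2 * \sum_(1 <= i < N.+1) d i * (a i - a i.-1).
  rewrite mulr_sumr; apply: eq_big_nat => -[|i] // _; rewrite /d /a /=; ring.
rewrite (summation_by_parts a d N0) -sumrB.
have -> : forall S : R,
    - c * (h ^- 2 * (d N * a N - d 1%N * a 0%N - S))
    + c / h ^+ 2 * ((u N - v N) * (u N.+1 - u N)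
                    - (u 1%N - v 1%N) * (u 1%N - u 0%N))
    = c / h ^+ 2 * S by move=> S; rewrite /d /a; ring.
rewrite mulr_sumr; apply: ler_sum => i _; rewrite -subr_ge0.
have -> : c / h ^+ 2 * (a i * (d i.+1 - d i))
    - (c / 2 * ((u i.+1 - u i) / h) ^+ 2 - c / 2 * ((v i.+1 - v i) / h) ^+ 2)
    = c / 2 * ((d i.+1 - d i) / h) ^+ 2.
  by rewrite /d /a !exprMn exprVn; move: (h ^- 2) => k; field.
by rewrite mulr_ge0 ?divr_ge0 ?sqr_ge0.
Qed.

Lemma mobility_ge0 (R : realType) (a b : R) : 0 <= mobility a b.
Proof. by rewrite /mobility mulr_ge0 // le_max lexx orbT. Qed.

(** Only the branch selected by the sign of the velocity survives, and it
    contributes its mobility times the squared velocity. *)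
Lemma upwind_flux_dissipation (R : realType) (v a b : R) :
  Num.min (mobility a b) (mobility b a) * `|v| ^+ 2 <= upwind_flux v a b * v.
Proof.
rewrite real_normK ?num_real // /upwind_flux.
case: (leP 0 v) => v0.
  rewrite mul0r addr0 mulrAC -expr2 mulrC ler_wpM2l ?sqr_ge0 //.
  by rewrite ge_min lexx.
rewrite mul0r add0r mulrAC -expr2 mulrC ler_wpM2l ?sqr_ge0 //.
by rewrite ge_min lexx orbT.
Qed.

(** The work of the chemical potential against the mass moved along a line of
    cells.  Without flux through the end faces, summation by parts leaves only
    the products of flux and velocity on interior faces. *)
Lemma flux_work_le (R : realType) (N : nat) (dt h : R) (mu J V u : nat -> R) :
  (0 < N)%N -> 0 <= dt -> J 0%N = 0 -> J N = 0 ->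
  (forall i, (1 <= i < N)%N -> V i = - (1 / h) * (mu i.+1 - mu i)) ->
  (forall i, (1 <= i < N)%N -> J i = upwind_flux (V i) (u i) (u i.+1)) ->
  \sum_(1 <= i < N.+1) mu i * (- (dt / h) * (J i - J i.-1))
  <= - dt * (\sum_(1 <= i < N)
       Num.min (mobility (u i) (u i.+1)) (mobility (u i.+1) (u i))
       * `|V i| ^+ 2).
Proof.
move=> N0 dt0 J0 JN hV hJ.
have -> : \sum_(1 <= i < N.+1) mu i * (- (dt / h) * (J i - J i.-1))
          = - (dt / h) * \sum_(1 <= i < N.+1) mu i * (J i - J i.-1).
  by rewrite mulr_sumr; apply: eq_bigr => i _; rewrite mulrCA.
rewrite (summation_by_parts J mu N0) J0 JN !mulr0 subrr sub0r mulrNN.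
rewrite mulNr -mulrN -sumrN !mulr_sumr !big_nat.
apply: ler_sum => i hi.
have -> : dt / h * (J i * (mu i.+1 - mu i)) = dt * - (J i * V i).
  by rewrite hV //; ring.
by rewrite ler_wpM2l // lerN2 hJ // upwind_flux_dissipation.
Qed.

(** * Dissipation in one sweep *)

Section OneSweep.
Context (R : realType) (eps kappa dt dx dy : R) (F g : R -> R) (Nx Ny : nat).
Hypotheses (heps : 0 < eps) (hkappa : 0 < kappa) (hdt : 0 < dt).
Hypotheses (hdx : 0 < dx) (hdy : 0 < dy) (hNx : (0 < Nx)%N) (hNy : (0 < Ny)%N).

Local Notation energy := (discrete_energy eps dx dy F g Nx Ny).

Local Notation face_mobility a b := (Num.min (mobility a b) (mobility b a)).

Let dxdy_ge0 : 0 <= dx * dy.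
Proof. by rewrite mulr_ge0 ?ltW. Qed.

(** The values outside the cells are ghosts, which differ from one sweep to the
    next; the energy has to ignore them for the sweeps to telescope. *)
Lemma discrete_energy_ext (u v : nat -> nat -> R) :
  (forall i j, cell Nx Ny i j -> u i j = v i j) -> energy u = energy v.
Proof.
move=> uv; rewrite /discrete_energy.
have uvE i j : (1 <= i)%N -> (i <= Nx)%N -> (1 <= j)%N -> (j <= Ny)%N ->
    u i j = v i j by move=> ? ? ? ?; apply: uv; apply/andP; split; apply/andP.
congr (_ * _ + _ * _ + _ * _ + _ * _).
- apply: eq_big_nat => i /andP[i1 iN]; apply: eq_big_nat => j /andP[j1 jN].
  by rewrite !uvE // ltnW.
- apply: eq_big_nat => i /andP[i1 iN]; apply: eq_big_nat => j /andP[j1 jN].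
  by rewrite !uvE // ltnW.
- apply: eq_big_nat => i /andP[i1 iN]; apply: eq_big_nat => j /andP[j1 jN].
  by rewrite uvE.
- by apply: eq_big_nat => i /andP[i1 iN]; rewrite uvE.
Qed.

(** Convexity of the gradient energy and the defining relations of the two
    multipliers reduce the increment of the energy to the work of the chemical
    potential; the relaxation of the contact line only lowers it further. *)
Lemma sweep_common_dissipation (v : nat -> nat -> R) (s : @sweep R) :
  sweep_common eps kappa dt dx dy F g Nx Ny v s ->
  energy (sphi s) - energy v
  <= dx * dy * (\sum_(1 <= i < Nx.+1) \sum_(1 <= j < Ny.+1)
                  smu s i j * (sphi s i j - v i j)).
Proof.
case=> hmu hxi heta hl hr ht hw; set u := sphi s in hmu hxi heta hl hr ht hw *.
pose Lx i j := (u i.+1 j - 2 * u i j + u i.-1 j) / dx ^+ 2.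
pose Ly i j := (u i j.+1 - 2 * u i j + u i j.-1) / dy ^+ 2.
have eps2 : 0 <= eps ^+ 2 by rewrite sqr_ge0.
set Gx := fun w : nat -> nat -> R => \sum_(1 <= i < Nx)
  \sum_(1 <= j < Ny.+1) eps ^+ 2 / 2 * ((w i.+1 j - w i j) / dx) ^+ 2.
set Gy := fun w : nat -> nat -> R => \sum_(1 <= i < Nx.+1)
  \sum_(1 <= j < Ny) eps ^+ 2 / 2 * ((w i j.+1 - w i j) / dy) ^+ 2.
set SF := \sum_(1 <= i < Nx.+1) \sum_(1 <= j < Ny.+1)
  derive1 F (u i j) * (u i j - v i j) in hxi.
set Sg := \sum_(1 <= i < Nx.+1)
  derive1 g (u i 1%N) * (u i 1%N - v i 1%N) in heta.
set SLx := \sum_(1 <= i < Nx.+1) \sum_(1 <= j < Ny.+1) (u i j - v i j) * Lx i j.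
set SLy := \sum_(1 <= i < Nx.+1) \sum_(1 <= j < Ny.+1) (u i j - v i j) * Ly i j.
set Sd := \sum_(1 <= i < Nx.+1) (u i 1%N - v i 1%N) ^+ 2.
(* The lateral ghosts copy the adjacent cells, so no boundary term appears. *)
have Gx_le : Gx u - Gx v <= - eps ^+ 2 * SLx.
  have GxE w : Gx w = \sum_(1 <= j < Ny.+1) \sum_(1 <= i < Nx)
      eps ^+ 2 / 2 * ((w i.+1 j - w i j) / dx) ^+ 2.
    exact: exchange_big_nat.
  have -> : SLx = \sum_(1 <= j < Ny.+1) \sum_(1 <= i < Nx.+1)
      (u i j - v i j) * Lx i j by exact: exchange_big_nat.
  rewrite !GxE -sumrB mulr_sumr big_nat [leRHS]big_nat; apply: ler_sum => j hj.
  apply: le_trans (dirichlet_increment_le dx (u^~ j) (v^~ j) hNx eps2) _.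
  by rewrite hl // hr // !subrr !mulr0 subrr mulr0 addr0.
(* The top ghosts copy the adjacent cells as well; the wall ghosts contribute
   the contact line term, divided by [dy] since it lives on a line. *)
have Gy_le : Gy u - Gy v <= - eps ^+ 2 * SLy
    - (Sd / (kappa * dt) + seta s * Sg) / dy.
  rewrite /Sd [_ / (kappa * dt)]mulr_suml /Sg [seta s * _]mulr_sumr -big_split /= mulr_suml.
  rewrite /SLy mulr_sumr /Gy -!sumrB.
  rewrite big_nat [leRHS]big_nat; apply: ler_sum => i hi.
  apply: le_trans (dirichlet_increment_le dy (u i) (v i) hNy eps2) _.
  rewrite lerD2l ht // hw // subrr mulr0 sub0r le_eqVlt; apply/orP; left.
  by apply/eqP; field; rewrite !gt_eqF.
have work : \sum_(1 <= i < Nx.+1) \sum_(1 <= j < Ny.+1)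
      smu s i j * (u i j - v i j)
    = - eps ^+ 2 * SLx + - eps ^+ 2 * SLy + sxi s * SF.
  rewrite /SLx /SLy /SF !mulr_sumr -!big_split /=.
  apply: eq_big_nat => i hi; rewrite !mulr_sumr -!big_split /=.
  apply: eq_big_nat => j hj.
  by rewrite hmu ?/cell ?hi // /laplacian /Lx /Ly; ring.
rewrite work /discrete_energy -/(Gx u) -/(Gx v) -/(Gy u) -/(Gy v).
have dF : \sum_(1 <= i < Nx.+1) \sum_(1 <= j < Ny.+1) F (u i j)
    = \sum_(1 <= i < Nx.+1) \sum_(1 <= j < Ny.+1) F (v i j) + sxi s * SF.
  rewrite -hxi -big_split /=; apply: eq_bigr => i _; rewrite -big_split /=.
  by apply: eq_bigr => j _; rewrite addrC subrK.
have dg : \sum_(1 <= i < Nx.+1) g (u i 1%N)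
    = \sum_(1 <= i < Nx.+1) g (v i 1%N) + seta s * Sg.
  by rewrite -heta -big_split /=; apply: eq_bigr => i _; rewrite addrC subrK.
rewrite dF dg.
have Sd0 : 0 <= dx * (Sd / (kappa * dt)).
  apply: (mulr_ge0 (ltW hdx)); apply: divr_ge0; last by rewrite mulr_ge0 ?ltW.
  by apply: sumr_ge0 => i _; rewrite sqr_ge0.
(* The wall term [seta s * Sg] produced here is cancelled by the increment of
   the wall energy [dg]. *)
have := lerD (ler_wpM2l dxdy_ge0 Gx_le) (ler_wpM2l dxdy_ge0 Gy_le).
have -> : dx * dy * (- eps ^+ 2 * SLy
                     - (Sd / (kappa * dt) + seta s * Sg) / dy)
    = dx * dy * (- eps ^+ 2 * SLy) - dx * (Sd / (kappa * dt))
      - dx * (seta s * Sg) by field; rewrite !gt_eqF.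
lra.
Qed.

Lemma sum_nat_single (N q : nat) (f : nat -> R) :
  (1 <= q <= N)%N -> (forall j, (1 <= j <= N)%N -> j != q -> f j = 0) ->
  \sum_(1 <= j < N.+1) f j = f q.
Proof.
move=> hq f0; rewrite (bigD1_seq q) ?iota_uniq ?mem_index_iota //=.
rewrite big1_seq ?addr0 // => j /andP[jq]; rewrite mem_index_iota => hj.
exact: f0.
Qed.

(** Only row [q] changes, so the work of the chemical potential reduces to that
    of the horizontal fluxes along this row. *)
Lemma row_sweep_dissipation (q : nat) (v : nat -> nat -> R) (s : @sweep R) :
  (1 <= q <= Ny)%N ->
  row_sweep eps kappa dt dx dy F g Nx Ny q v s ->
  energy (sphi s) - energy v
  <= dx * dy * (- dt * \sum_(1 <= i < Nx)
       face_mobility (sphi s i q) (sphi s i.+1 q) * `|svel s i q| ^+ 2).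
Proof.
move=> hq [hup hvel hflux hno /sweep_common_dissipation/le_trans]; apply.
rewrite ler_wpM2l ?dxdy_ge0 // exchange_big_nat /=.
rewrite (sum_nat_single hq) => [|j hj /negPf jq]; last first.
  by rewrite big_nat big1 // => i hi; rewrite hup ?/cell ?hi // jq mulr0.
rewrite (eq_big_nat _ _ (F2 := fun i => smu s i q
    * (- (dt / dx) * (sflux s i q - sflux s i.-1 q)))); last first.
  by move=> i hi; rewrite hup ?/cell ?hi // eqxx.
have [J0 JN] := hno q hq.
apply: (flux_work_le (mu := smu s ^~ q) (u := sphi s ^~ q)) => //; first exact: ltW.
- by move=> i hi; apply: hvel.
- by move=> i hi; apply: hflux.
Qed.

Lemma column_sweep_dissipation (p : nat) (v : nat -> nat -> R) (s : @sweep R) :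
  (1 <= p <= Nx)%N ->
  column_sweep eps kappa dt dx dy F g Nx Ny p v s ->
  energy (sphi s) - energy v
  <= dx * dy * (- dt * \sum_(1 <= j < Ny)
       face_mobility (sphi s p j) (sphi s p j.+1) * `|svel s p j| ^+ 2).
Proof.
move=> hp [hup hvel hflux hno /sweep_common_dissipation/le_trans]; apply.
rewrite ler_wpM2l ?dxdy_ge0 //.
rewrite (sum_nat_single hp) => [|i hi /negPf ip]; last first.
  by rewrite big_nat big1 // => j hj; rewrite hup ?/cell ?hi // ip mulr0.
rewrite (eq_big_nat _ _ (F2 := fun j => smu s p j
    * (- (dt / dy) * (sflux s p j - sflux s p j.-1)))); last first.
  by move=> j hj; rewrite hup ?/cell ?hp // eqxx.
have [J0 JN] := hno p hp.
apply: flux_work_le => //; first exact: ltW.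
- by move=> j hj; apply: hvel.
- by move=> j hj; apply: hflux.
Qed.

End OneSweep.

(** * Dissipation in one time step *)

Lemma telescoping_increment_le (R : numDomainType) (N : nat) (e b : nat -> R) :
  (forall q, (1 <= q <= N)%N -> e q - e q.-1 <= b q) ->
  e N - e 0%N <= \sum_(1 <= q < N.+1) b q.
Proof.
move=> he; rewrite big_add1 /= -(telescope_sumr e (leq0n N)).
rewrite [leLHS]big_nat [leRHS]big_nat; apply: ler_sum => q hq; exact: (he q.+1).
Qed.

Theorem theorem6 (R : realType) (eps kappa dt dx dy thetas beta : R)
    (F : R -> R) (Nx Ny N : nat)
    (heps : 0 < eps < 1) (hkappa : 0 < kappa) (hdt : 0 < dt)
    (hdx : 0 < dx) (hdy : 0 < dy) (hthetas : 0 <= thetas <= pi)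
    (hNx : (0 < Nx)%N) (hNy : (0 < Ny)%N) (hN : (0 < N)%N)
    (hF : potential beta F)
    (phi : nat -> nat -> nat -> R) (row col : nat -> nat -> @sweep R)
    (xi eta : nat -> R)
    (hsol : scheme_solution eps kappa dt dx dy F (wall_energy eps thetas beta F)
              Nx Ny N phi row col xi eta) :
  let W k := discrete_energy eps dx dy F (wall_energy eps thetas beta F)
               Nx Ny (phi k) in
  forall n, (n < N)%N ->
  let D :=
    - dx * dy * (\sum_(1 <= p < Nx.+1) \sum_(1 <= j < Ny)
        Num.min
          (mobility (sphi (col n p) p j) (sphi (col n p) p j.+1))
          (mobility (sphi (col n p) p j.+1) (sphi (col n p) p j))
        * `|svel (col n p) p j| ^+ 2)
    - dx * dy * (\sum_(1 <= i < Nx) \sum_(1 <= q < Ny.+1)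
        Num.min
          (mobility (sphi (row n q) i q) (sphi (row n q) i.+1 q))
          (mobility (sphi (row n q) i.+1 q) (sphi (row n q) i q))
        * `|svel (row n q) i q| ^+ 2) in
  [/\ W n.+1 <= W n, (W n.+1 - W n) / dt <= D & D <= 0].
Proof.
move=> W n hn D.
have eps0 : 0 < eps by case/andP: heps.
case: (hsol n hn) => hrow0 hrow hcol0 hcol hphi _ _.
set g := wall_energy _ _ _ _ in hrow hcol W *.
pose E := discrete_energy eps dx dy F g Nx Ny.
(* The three identifications of the phase variables of [phi n] and [row n 0],
   of [row n Ny] and [col n 0], and of [col n Nx] and [phi n.+1] hold on cells
   only, which is all that the energy sees. *)
have W0 : E (sphi (row n 0%N)) = W n by exact: discrete_energy_ext.
have Wmid : E (sphi (col n 0%N)) = E (sphi (row n Ny)).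
  exact: discrete_energy_ext.
have W1 : W n.+1 = E (sphi (col n Nx)) by exact: discrete_energy_ext.
have := telescoping_increment_le (e := fun q => E (sphi (row n q)))
  (fun q hq => row_sweep_dissipation eps0 hkappa hdt hdx hdy hNx hNy hq
                 (hrow q hq)).
have := telescoping_increment_le (e := fun p => E (sphi (col n p)))
  (fun p hp => column_sweep_dissipation eps0 hkappa hdt hdx hdy hNx hNy hp
                 (hcol p hp)).
rewrite -!mulr_sumr W0 Wmid -W1 => hcols.
rewrite exchange_big_nat /= => hrows.
have min_ge0 a b (v : R) :
    0 <= Num.min (mobility a b) (mobility b a) * `|v| ^+ 2.
  by rewrite mulr_ge0 ?sqr_ge0 // le_min !mobility_ge0.
have D_le0 : D <= 0.
  rewrite /D !mulNr -opprD oppr_le0 -mulrDr.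
  apply: mulr_ge0; first by rewrite mulr_ge0 ?ltW.
  by apply: addr_ge0; apply: sumr_ge0 => i _; apply: sumr_ge0.
have W_le : W n.+1 - W n <= D * dt.
  rewrite /D; move: hcols hrows; lra.
split=> //; last by rewrite ler_pdivrMr.
rewrite -subr_le0; apply: le_trans W_le _.
by rewrite mulr_le0_ge0 // ltW.
Qed.
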